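(* Let $I_1,I_2\subset\mathbf{R}$ be open intervals, let $\gamma=(\gamma_1,\gamma_2):I_1\to S^3$ be a unit speed Legendre curve in $S^3$ and $\alpha=(\alpha_1,\alpha_2):I_2\to H^3_1$ a unit speed Legendre curve in $H^3_1$, such that the map $$\phi:I_2\times I_1\to\mathbf{C}^2,\qquad \phi(t,s)=(\alpha_1(t)\gamma_1(s),\,\alpha_2(t)\gamma_2(s)),$$ is a (Lagrangian conformal) immersion. Let $\rho>0$ be a real number. Then $\phi$ has constant mean curvature $|H|\equiv\rho$ if and only if there exists $\lambda\in\mathbf{R}$ such that $$k_\gamma^2=4\rho^2|\gamma_1|^2-\lambda\quad\text{and}\quad k_\alpha^2=4\rho^2|\alpha_1|^2+\lambda .$$
   Context: Curves are smooth. $S^3=\{(z,w)\in\mathbf{C}^2:|z|^2+|w|^2=1\}$. A unit speed Legendre curve $\gamma$ in $S^3$ satisfies $|\gamma_1|^2+|\gamma_2|^2=1$, $|\gamma_1'|^2+|\gamma_2'|^2=1$, $\gamma_1'\bar\gamma_1+\gamma_2'\bar\gamma_2=0$. $H^3_1=\{(z,w)\in\mathbf{C}^2:|z|^2-|w|^2=-1\}$. A unit speed Legendre curve $\alpha$ in $H^3_1$ satisfies $|\alpha_1|^2-|\alpha_2|^2=-1$, $|\alpha_1'|^2-|\alpha_2'|^2=1$, $\alpha_1'\bar\alpha_1-\alpha_2'\bar\alpha_2=0$. $k_\gamma$ and $k_\alpha$ are the (signed) curvature functions of $\gamma$ and $\alpha$: $k_\gamma=\mathrm{Re}\big(\gamma_1''\overline{i\gamma_1'}+\gamma_2''\overline{i\gamma_2'}\big)$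 and $k_\alpha=\mathrm{Re}\big(\alpha_1''\overline{i\alpha_1'}-\alpha_2''\overline{i\alpha_2'}\big)$; equivalently they are the real functions with $\gamma''-ik_\gamma\gamma'+\gamma=0$ and $\alpha''-ik_\alpha\alpha'-\alpha=0$. The metric induced by $\phi$ from the Euclidean metric is $(|\gamma_1|^2+|\alpha_1|^2)(dt^2+ds^2)$, so $\phi$ is an immersion exactly when $|\gamma_1(s)|^2+|\alpha_1(t)|^2\neq0$ everywhere. $H=\frac12\mathrm{trace}\,\sigma$ is the mean curvature vector of $\phi$ ($\sigma$ the second fundamental form), and $|H|$ is its Euclidean norm. *)

(* Defs.v *)
From Stdlib Require Import Reals.
From Coquelicot Require Import Coquelicot.
Open Scope R_scope.

(** Open intervals, possibly unbounded. *)
Definition open_itv (a b : Rbar) (x : R) : Prop := Rbar_lt a x /\ Rbar_lt x b.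

(** ** The plane C^2 as a real Euclidean space *)

Definition C2 : Type := (C * C)%type.

Definition C2zero : C2 := (RtoC 0, RtoC 0).
Definition C2plus (v w : C2) : C2 :=
  (Cplus (fst v) (fst w), Cplus (snd v) (snd w)).
Definition C2scal (r : R) (v : C2) : C2 :=
  (Cmult (RtoC r) (fst v), Cmult (RtoC r) (snd v)).
Definition C2minus (v w : C2) : C2 := C2plus v (C2scal (-1) w).
Definition C2mulI (v : C2) : C2 := (Cmult Ci (fst v), Cmult Ci (snd v)).

(** Hermitian forms of signature (2,0) and (1,1), conjugate-linear in the
    second argument. *)
Definition herm (v w : C2) : C :=
  Cplus (Cmult (fst v) (Cconj (fst w))) (Cmult (snd v) (Cconj (snd w))).
Definition herm11 (v w : C2) : C :=
  Cminus (Cmult (fst v) (Cconj (fst w))) (Cmult (snd v) (Cconj (snd w))).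

Definition inner (v w : C2) : R := Re (herm v w).
Definition C2norm (v : C2) : R := sqrt (inner v v).

(** ** Curves in C^2 *)

Definition smooth_fun_on (D : R -> Prop) (f : R -> R) : Prop :=
  forall (n : nat) (x : R), D x -> ex_derive_n f n x.

(** Curves are total functions on [R]; only their values on [D] matter. *)
Definition smooth_curve_on (D : R -> Prop) (c : R -> C2) : Prop :=
  smooth_fun_on D (fun x => Re (fst (c x))) /\
  smooth_fun_on D (fun x => Im (fst (c x))) /\
  smooth_fun_on D (fun x => Re (snd (c x))) /\
  smooth_fun_on D (fun x => Im (snd (c x))).

Definition DeriveC (f : R -> C) (x : R) : C :=
  (Derive (fun y => Re (f y)) x, Derive (fun y => Im (f y)) x).
Definition DeriveC2 (c : R -> C2) (x : R) : C2 :=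
  (DeriveC (fun y => fst (c y)) x, DeriveC (fun y => snd (c y)) x).

Definition legendre_S3 (D : R -> Prop) (c : R -> C2) : Prop :=
  smooth_curve_on D c /\
  forall s, D s ->
    Cmod (fst (c s)) ^ 2 + Cmod (snd (c s)) ^ 2 = 1 /\
    Cmod (fst (DeriveC2 c s)) ^ 2 + Cmod (snd (DeriveC2 c s)) ^ 2 = 1 /\
    herm (DeriveC2 c s) (c s) = RtoC 0.

Definition legendre_H31 (D : R -> Prop) (c : R -> C2) : Prop :=
  smooth_curve_on D c /\
  forall t, D t ->
    Cmod (fst (c t)) ^ 2 - Cmod (snd (c t)) ^ 2 = -1 /\
    Cmod (fst (DeriveC2 c t)) ^ 2 - Cmod (snd (DeriveC2 c t)) ^ 2 = 1 /\
    herm11 (DeriveC2 c t) (c t) = RtoC 0.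

Definition curvature_S3 (c : R -> C2) (s : R) : R :=
  Re (herm (DeriveC2 (DeriveC2 c) s) (C2mulI (DeriveC2 c s))).
Definition curvature_H31 (c : R -> C2) (t : R) : R :=
  Re (herm11 (DeriveC2 (DeriveC2 c) t) (C2mulI (DeriveC2 c t))).

(** ** Parametrized surfaces in C^2 *)

Definition partial1 (f : R -> R -> C2) (t s : R) : C2 :=
  DeriveC2 (fun t' => f t' s) t.
Definition partial2 (f : R -> R -> C2) (t s : R) : C2 :=
  DeriveC2 (fun s' => f t s') s.

(** Injectivity of the differential of a map that is already smooth. *)
Definition immersion_on (D1 D2 : R -> Prop) (f : R -> R -> C2) : Prop :=
  forall t s, D1 t -> D2 s -> forall a b : R,
    C2plus (C2scal a (partial1 f t s)) (C2scal b (partial2 f t s)) = C2zero ->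
    a = 0 /\ b = 0.

(** Coefficients and determinant of the induced metric. *)
Definition g11 (f : R -> R -> C2) (t s : R) : R :=
  inner (partial1 f t s) (partial1 f t s).
Definition g12 (f : R -> R -> C2) (t s : R) : R :=
  inner (partial1 f t s) (partial2 f t s).
Definition g22 (f : R -> R -> C2) (t s : R) : R :=
  inner (partial2 f t s) (partial2 f t s).
Definition detg (f : R -> R -> C2) (t s : R) : R :=
  g11 f t s * g22 f t s - g12 f t s ^ 2.

(** Orthogonal projections at (t, s): the tangential one is
    sum_{i,j} g^{ij} <v, f_i> f_j. *)
Definition tangent_part (f : R -> R -> C2) (t s : R) (v : C2) : C2 :=
  let v1 := inner v (partial1 f t s) in
  let v2 := inner v (partial2 f t s) in
  C2plus
    (C2scal ((g22 f t s * v1 - g12 f t s * v2) / detg f t s) (partial1 f t s))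
    (C2scal ((g11 f t s * v2 - g12 f t s * v1) / detg f t s) (partial2 f t s)).
Definition normal_part (f : R -> R -> C2) (t s : R) (v : C2) : C2 :=
  C2minus v (tangent_part f t s v).

(** Second fundamental form on the coordinate vector fields. *)
Definition sigma11 (f : R -> R -> C2) (t s : R) : C2 :=
  normal_part f t s (partial1 (partial1 f) t s).
Definition sigma12 (f : R -> R -> C2) (t s : R) : C2 :=
  normal_part f t s (partial1 (partial2 f) t s).
Definition sigma22 (f : R -> R -> C2) (t s : R) : C2 :=
  normal_part f t s (partial2 (partial2 f) t s).

(** Trace with respect to the induced metric: sum_{i,j} g^{ij} sigma_{ij}. *)
Definition trace_sigma (f : R -> R -> C2) (t s : R) : C2 :=
  C2plus
    (C2scal (g22 f t s / detg f t s) (sigma11 f t s))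
    (C2plus
      (C2scal (- 2 * g12 f t s / detg f t s) (sigma12 f t s))
      (C2scal (g11 f t s / detg f t s) (sigma22 f t s))).

Definition mean_curvature_vector (f : R -> R -> C2) (t s : R) : C2 :=
  C2scal (1 / 2) (trace_sigma f t s).

Definition product_surface (alpha gamma : R -> C2) (t s : R) : C2 :=
  (Cmult (fst (alpha t)) (fst (gamma s)), Cmult (snd (alpha t)) (snd (gamma s))).

(* Main.v *)
Require Import Defs.
From Stdlib Require Import Reals Lra.
From Coquelicot Require Import Coquelicot.
Open Scope R_scope.

(** A unit speed Legendre curve [c] in the quadric [<c,c> = eps] (with
    [eps = 1] for the sphere, [eps = -1] for the anti-de Sitter space) carries
    the frame [c, c'], which is orthogonal for the Hermitian form of signature
    [(1, eps)]. Differentiating [<c',c> = 0] and [<c',c'> = 1] determines the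
    products of [c''] with the frame, hence
    [c'' = i k c' - eps c] ([legendre_curve_ode]). The frame identities also
    express the moduli of the other entries through [|c_1|] ([legendre_frame_moduli]), so the
    product surface [phi] is conformal with factor
    [e = |gamma_1|^2 + |alpha_1|^2], and [<phi_t, phi_s> = 0] over the complex
    numbers, i.e. [phi] is Lagrangian ([product_surface_conformal]).

    The terms [+ alpha] and [- gamma] of the two differential equations cancel
    in the sum of the pure second derivatives, leaving
    [phi_tt + phi_ss = i (k_alpha phi_t + k_gamma phi_s)]
    ([product_surface_laplacian]). Since [phi] is Lagrangian this vector is
    normal, so [H] is [1 / (2 e)] times it, and
    [|H|^2 = (k_alpha^2 + k_gamma^2) / (4 e)]
    ([conformal_lagrangian_mean_curvature]).

    Hence [|H| = rho] reads
    [k_alpha(t)^2 - 4 rho^2 |alpha_1(t)|^2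
       = - (k_gamma(s)^2 - 4 rho^2 |gamma_1(s)|^2)].
    The variables are separated, so both sides equal a constant [lambda]. *)

(** * Differentiating complex-valued functions of a real variable *)

Definition is_deriveC (f : R -> C) (x : R) (l : C) : Prop :=
  is_derive (fun y => Re (f y)) x (Re l) /\ is_derive (fun y => Im (f y)) x (Im l).

Lemma is_deriveC_unique f x l : is_deriveC f x l -> DeriveC f x = l.
Proof.
intros [h1 h2]. destruct l as [l1 l2].
unfold DeriveC. f_equal; now apply is_derive_unique.
Qed.

Lemma is_deriveC_ext_loc f g x l :
  locally x (fun y => f y = g y) -> is_deriveC f x l -> is_deriveC g x l.
Proof.
intros he [h1 h2]; split.
- apply (is_derive_ext_loc (fun y => Re (f y))); trivial.
  now apply (filter_imp _ _ (fun y (e : f y = g y) => f_equal Re e)).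
- apply (is_derive_ext_loc (fun y => Im (f y))); trivial.
  now apply (filter_imp _ _ (fun y (e : f y = g y) => f_equal Im e)).
Qed.

Lemma is_deriveC_const (k : C) x : is_deriveC (fun _ => k) x (RtoC 0).
Proof. split; [exact (is_derive_const (Re k) x) | exact (is_derive_const (Im k) x)]. Qed.

Lemma is_deriveC_plus f g x l m :
  is_deriveC f x l -> is_deriveC g x m ->
  is_deriveC (fun y => Cplus (f y) (g y)) x (Cplus l m).
Proof.
intros [h1 h2] [h3 h4]; split; simpl.
- now apply (is_derive_plus (fun y => Re (f y)) (fun y => Re (g y))).
- now apply (is_derive_plus (fun y => Im (f y)) (fun y => Im (g y))).
Qed.

Lemma is_deriveC_conj f x l :
  is_deriveC f x l -> is_deriveC (fun y => Cconj (f y)) x (Cconj l).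
Proof.
intros [h1 h2]; split; simpl; trivial.
now apply (is_derive_opp (fun y => Im (f y))).
Qed.

Lemma is_deriveC_mult f g x l m :
  is_deriveC f x l -> is_deriveC g x m ->
  is_deriveC (fun y => Cmult (f y) (g y)) x (Cplus (Cmult l (g x)) (Cmult (f x) m)).
Proof.
intros [h1 h2] [h3 h4].
pose proof (Derive.is_derive_mult _ _ _ _ _ h1 h3) as rr.
pose proof (Derive.is_derive_mult _ _ _ _ _ h2 h4) as ii.
pose proof (Derive.is_derive_mult _ _ _ _ _ h1 h4) as ri.
pose proof (Derive.is_derive_mult _ _ _ _ _ h2 h3) as ir.
split.
- evar_last.
  + exact (is_derive_minus _ _ _ _ _ rr ii).
  + unfold minus, plus, opp; simpl; unfold Re, Im; simpl; ring.
- evar_last.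
  + exact (is_derive_plus _ _ _ _ _ ri ir).
  + unfold plus; simpl; unfold Re, Im; simpl; ring.
Qed.

Lemma is_deriveC_mult_const f (k : C) x l :
  is_deriveC f x l -> is_deriveC (fun y => Cmult (f y) k) x (Cmult l k).
Proof.
intros h.
replace (Cmult l k) with (Cplus (Cmult l k) (Cmult (f x) (RtoC 0))) by ring.
apply (is_deriveC_mult f (fun _ => k)); trivial.
apply is_deriveC_const.
Qed.

Lemma is_deriveC_const_mult f (k : C) x l :
  is_deriveC f x l -> is_deriveC (fun y => Cmult k (f y)) x (Cmult k l).
Proof.
intros h.
replace (Cmult k l) with (Cplus (Cmult (RtoC 0) (f x)) (Cmult k l)) by ring.
apply (is_deriveC_mult (fun _ => k) f); trivial.
apply is_deriveC_const.
Qed.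

Definition is_deriveC2 (c : R -> C2) (x : R) (l : C2) : Prop :=
  is_deriveC (fun y => fst (c y)) x (fst l) /\
  is_deriveC (fun y => snd (c y)) x (snd l).

Lemma is_deriveC2_unique c x l : is_deriveC2 c x l -> DeriveC2 c x = l.
Proof.
intros [h1 h2]. destruct l as [l1 l2].
unfold DeriveC2. f_equal; now apply is_deriveC_unique.
Qed.

Lemma is_deriveC2_ext_loc c d x l :
  locally x (fun y => c y = d y) -> is_deriveC2 c x l -> is_deriveC2 d x l.
Proof.
intros he [h1 h2]; split.
- apply (is_deriveC_ext_loc (fun y => fst (c y))); trivial.
  now apply (filter_imp _ _ (fun y (e : c y = d y) => f_equal fst e)).
- apply (is_deriveC_ext_loc (fun y => snd (c y))); trivial.
  now apply (filter_imp _ _ (fun y (e : c y = d y) => f_equal snd e)).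
Qed.

(** The iterated derivatives [Derive_n] of order 1 and 2 are convertible to
    [Derive] applied once and twice. *)
Lemma smooth_curve_derive D c x :
  smooth_curve_on D c -> D x -> is_deriveC2 c x (DeriveC2 c x).
Proof.
intros (h1 & h2 & h3 & h4) hx.
split; split; apply Derive_correct.
- exact (h1 1%nat x hx).
- exact (h2 1%nat x hx).
- exact (h3 1%nat x hx).
- exact (h4 1%nat x hx).
Qed.

Lemma smooth_curve_derive2 D c x :
  smooth_curve_on D c -> D x ->
  is_deriveC2 (DeriveC2 c) x (DeriveC2 (DeriveC2 c) x).
Proof.
intros (h1 & h2 & h3 & h4) hx.
split; split; apply Derive_correct.
- exact (h1 2%nat x hx).
- exact (h2 2%nat x hx).
- exact (h3 2%nat x hx).
- exact (h4 2%nat x hx).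
Qed.

Lemma open_itv_locally a b x : open_itv a b x -> locally x (open_itv a b).
Proof.
apply (locally_open (open_itv a b)); trivial.
apply open_and; [apply open_Rbar_gt | apply open_Rbar_lt].
Qed.

Lemma open_itv_inhabited a b : Rbar_lt a b -> exists x, open_itv a b x.
Proof.
unfold open_itv.
destruct a as [a| |], b as [b| |]; simpl; intros h; try easy.
- exists ((a + b) / 2); lra.
- exists (a + 1); lra.
- exists (b - 1); lra.
- now exists 0.
Qed.

(** * Legendre curves in both quadrics *)

(** At [eps = 1] this is [herm], at [eps = -1] it is [herm11]; the two families
    of Legendre curves are then the single family with [<c,c> = eps],
    [<c',c'> = 1], [<c',c> = 0]. *)
Definition hermS (eps : R) (v w : C2) : C :=
  Cplus (Cmult (fst v) (Cconj (fst w)))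
        (Cmult (RtoC eps) (Cmult (snd v) (Cconj (snd w)))).

Lemma hermS_conj eps v w : hermS eps w v = Cconj (hermS eps v w).
Proof.
unfold hermS. rewrite Cplus_conj, !Cmult_conj, !Cconj_conj.
replace (Cconj (RtoC eps)) with (RtoC eps); [ring|].
apply injective_projections; simpl; ring.
Qed.

Lemma is_deriveC_hermS eps c d x l m :
  is_deriveC2 c x l -> is_deriveC2 d x m ->
  is_deriveC (fun y => hermS eps (c y) (d y)) x
    (Cplus (hermS eps l (d x)) (hermS eps (c x) m)).
Proof.
intros [h1 h2] [h3 h4].
pose proof (is_deriveC_mult _ _ _ _ _ h1 (is_deriveC_conj _ _ _ h3)) as k1.
pose proof (is_deriveC_mult _ _ _ _ _ h2 (is_deriveC_conj _ _ _ h4)) as k2.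
pose proof (is_deriveC_plus _ _ _ _ _ k1 (is_deriveC_const_mult _ (RtoC eps) _ _ k2)) as k.
unfold hermS.
match goal with |- is_deriveC _ _ ?l' =>
  match type of k with is_deriveC _ _ ?l =>
    replace l' with l by ring end end.
exact k.
Qed.

Definition legendre_frame (eps : R) (u v : C2) : Prop :=
  hermS eps u u = RtoC eps /\ hermS eps v v = RtoC 1 /\ hermS eps v u = RtoC 0.

(** The Gram matrix of the frame is invertible, so the frame is a basis and
    pairing with it is injective; [hdet] is the determinant of the Gram matrix
    up to the factor [eps], and Cramer's rule isolates each coordinate of
    [z]. *)
Lemma legendre_frame_nondegenerate eps u v z :
  eps * eps = 1 -> legendre_frame eps u v ->
  hermS eps z u = RtoC 0 -> hermS eps z v = RtoC 0 -> z = C2zero.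
Proof.
intros he (huu & hvv & hvu).
pose proof (hermS_conj eps v u) as huv.
rewrite hvu in huv.
replace (Cconj (RtoC 0)) with (RtoC 0) in huv
  by (apply injective_projections; simpl; ring).
assert (hE : Cmult (RtoC eps) (RtoC eps) = RtoC 1)
  by (rewrite <- RtoC_mult; now f_equal).
destruct u as [u1 u2], v as [v1 v2], z as [z1 z2].
unfold hermS in *; simpl fst in *; simpl snd in *.
set (E := RtoC eps) in *.
generalize dependent E. clear he.
generalize (Cconj u1), (Cconj u2), (Cconj v1), (Cconj v2).
intros p1 p2 q1 q2 E huu hvv hvu huv hE h1 h2.
assert (hdet : Cmult (u1 * v2 - u2 * v1)%C (p1 * q2 - p2 * q1)%C = RtoC 1).
{ replace (Cmult (u1 * v2 - u2 * v1)%C (p1 * q2 - p2 * q1)%C) with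
    ((E * E) * ((u1 * v2 - u2 * v1) * (p1 * q2 - p2 * q1)))%C by (rewrite hE; ring).
  transitivity (E * ((u1 * p1 + E * (u2 * p2)) * (v1 * q1 + E * (v2 * q2))
     - (v1 * p1 + E * (v2 * p2)) * (u1 * q1 + E * (u2 * q2))))%C; [ring|].
  rewrite huu, hvv, hvu, huv. transitivity (E * E)%C; [ring | exact hE]. }
unfold C2zero. f_equal.
- transitivity (((u1 * v2 - u2 * v1) * (p1 * q2 - p2 * q1)) * z1)%C;
    [rewrite hdet; ring|].
  transitivity ((u1 * v2 - u2 * v1) * (q2 * (z1 * p1 + E * (z2 * p2))
     - p2 * (z1 * q1 + E * (z2 * q2))))%C; [ring|].
  rewrite h1, h2. ring.
- transitivity ((E * E) * ((u1 * v2 - u2 * v1) * (p1 * q2 - p2 * q1)) * z2)%C;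
    [rewrite hdet, hE; ring|].
  transitivity (E * (u1 * v2 - u2 * v1) * (p1 * (z1 * q1 + E * (z2 * q2))
     - q1 * (z1 * p1 + E * (z2 * p2))))%C; [ring|].
  rewrite h1, h2. ring.
Qed.

(** Both sides have the same products with [u] and [v]; the factor [eps] on the
    first coefficient is [1 / <u,u>]. *)
Lemma legendre_frame_expansion eps u v w :
  eps * eps = 1 -> legendre_frame eps u v ->
  w = (Cplus (Cmult (RtoC eps * hermS eps w u) (fst u)) (Cmult (hermS eps w v) (fst v)),
       Cplus (Cmult (RtoC eps * hermS eps w u) (snd u)) (Cmult (hermS eps w v) (snd v))).
Proof.
intros he hf.
assert (hE : Cmult (RtoC eps) (RtoC eps) = RtoC 1)
  by (rewrite <- RtoC_mult; now f_equal).
set (a := (RtoC eps * hermS eps w u)%C). set (b := hermS eps w v).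
assert (hlin : forall y, hermS eps
   (fst w - (a * fst u + b * fst v), snd w - (a * snd u + b * snd v))%C y
   = (hermS eps w y - (a * hermS eps u y + b * hermS eps v y))%C).
{ intros y. unfold hermS; simpl. ring. }
assert (hz := legendre_frame_nondegenerate eps u v
   (fst w - (a * fst u + b * fst v), snd w - (a * snd u + b * snd v))%C he hf).
rewrite !hlin in hz.
destruct hf as (huu & hvv & hvu).
assert (huv : hermS eps u v = RtoC 0).
{ rewrite (hermS_conj eps v u), hvu. apply injective_projections; simpl; ring. }
rewrite huu, hvv, hvu, huv in hz.
assert (hzero : (fst w - (a * fst u + b * fst v), snd w - (a * snd u + b * snd v))%C = C2zero).
{ apply hz.
  - transitivity (hermS eps w u * (1 - RtoC eps * RtoC eps))%C;
      [unfold a; ring | rewrite hE; ring].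
  - unfold b. ring. }
apply injective_projections; apply Ceq_minus.
- exact (f_equal fst hzero).
- exact (f_equal snd hzero).
Qed.

(** Expanding the two standard basis vectors in the frame gives the diagonal
    entries of the completeness relation; [<u,u> = eps] supplies the third
    equation. *)
Lemma legendre_frame_moduli eps u v :
  eps * eps = 1 -> legendre_frame eps u v ->
  Cmod (snd u) ^ 2 = 1 - eps * Cmod (fst u) ^ 2 /\
  Cmod (fst v) ^ 2 = 1 - eps * Cmod (fst u) ^ 2 /\
  Cmod (snd v) ^ 2 = Cmod (fst u) ^ 2.
Proof.
intros he hf.
pose proof (f_equal fst (legendre_frame_expansion eps u v (RtoC 1, RtoC 0) he hf)) as h1.
pose proof (f_equal snd (legendre_frame_expansion eps u v (RtoC 0, RtoC 1) he hf)) as h2.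
destruct hf as (h0 & _ & _).
destruct u as [u1 u2], v as [v1 v2].
unfold hermS in *; simpl fst in *; simpl snd in *.
assert (k0 : Cmod u1 ^ 2 + eps * Cmod u2 ^ 2 = eps).
{ apply RtoC_inj. rewrite <- h0, RtoC_plus, RtoC_mult, !Cmod2_conj. reflexivity. }
assert (k1 : 1 = eps * Cmod u1 ^ 2 + Cmod v1 ^ 2).
{ apply RtoC_inj. rewrite h1, RtoC_plus, RtoC_mult, !Cmod2_conj. ring. }
assert (k2 : 1 = eps * eps * Cmod u2 ^ 2 + eps * Cmod v2 ^ 2).
{ apply RtoC_inj. rewrite h2, RtoC_plus, !RtoC_mult, !Cmod2_conj. ring. }
assert (k3 : Cmod u2 ^ 2 = 1 - eps * Cmod u1 ^ 2).
{ transitivity (eps * eps * Cmod u2 ^ 2); [rewrite he; ring|].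
  transitivity (eps * (Cmod u1 ^ 2 + eps * Cmod u2 ^ 2) - eps * Cmod u1 ^ 2); [ring|].
  now rewrite k0, he. }
repeat split; trivial; [lra|].
replace (Cmod v2 ^ 2) with (eps * eps * Cmod v2 ^ 2) by (rewrite he; ring).
replace (Cmod u1 ^ 2) with (eps * eps * Cmod u1 ^ 2) by (rewrite he; ring).
rewrite he, k3 in k2.
replace (eps * eps * Cmod v2 ^ 2) with (eps * (eps * Cmod v2 ^ 2)) by ring.
replace (eps * Cmod v2 ^ 2) with (eps * Cmod u1 ^ 2) by lra. ring.
Qed.

Definition legendre_curve (eps : R) (D : R -> Prop) (c : R -> C2) : Prop :=
  smooth_curve_on D c /\ forall x, D x -> legendre_frame eps (c x) (DeriveC2 c x).

Lemma hermS_1 v w : hermS 1 v w = herm v w.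
Proof. unfold hermS, herm. ring. Qed.

Lemma hermS_m1 v w : hermS (-1) v w = herm11 v w.
Proof.
unfold hermS, herm11.
replace (RtoC (-1)) with (- RtoC 1)%C by (rewrite <- RtoC_opp; f_equal; ring).
ring.
Qed.

Lemma legendre_S3_curve D c : legendre_S3 D c -> legendre_curve 1 D c.
Proof.
intros [hs h]. split; trivial. intros x hx.
destruct (h x hx) as (h1 & h2 & h3).
unfold legendre_frame. rewrite !hermS_1. repeat split; trivial; unfold herm.
- now rewrite <- h1, RtoC_plus, !Cmod2_conj.
- now rewrite <- h2, RtoC_plus, !Cmod2_conj.
Qed.

Lemma legendre_H31_curve D c : legendre_H31 D c -> legendre_curve (-1) D c.
Proof.
intros [hs h]. split; trivial. intros x hx.
destruct (h x hx) as (h1 & h2 & h3).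
unfold legendre_frame. rewrite !hermS_m1. repeat split; trivial; unfold herm11.
- now rewrite <- h1, RtoC_minus, !Cmod2_conj.
- now rewrite <- h2, RtoC_minus, !Cmod2_conj.
Qed.

(** Since [<c',c>] vanishes identically, [<c'',c> = - <c',c'> = -1]; since
    [<c',c'>] is constant, [<c'',c'>] is imaginary, and its imaginary part is
    the curvature. The frame expansion of [c''] then has these two
    coefficients. *)
Lemma legendre_curve_ode eps D c x :
  eps * eps = 1 -> legendre_curve eps D c -> locally x D ->
  DeriveC2 (DeriveC2 c) x =
  C2plus (C2mulI (C2scal (Re (hermS eps (DeriveC2 (DeriveC2 c) x) (C2mulI (DeriveC2 c x))))
                         (DeriveC2 c x)))
         (C2scal (- eps) (c x)).
Proof.
intros he [hs hf] hD.
assert (hx := locally_singleton _ _ hD).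
pose proof (smooth_curve_derive _ _ _ hs hx) as d1.
pose proof (smooth_curve_derive2 _ _ _ hs hx) as d2.
pose proof (is_deriveC_hermS eps _ _ _ _ _ d2 d1) as hu.
pose proof (is_deriveC_hermS eps _ _ _ _ _ d2 d2) as hv.
(* [<c',c>] and [<c',c'>] are constant on a neighbourhood of [x]. *)
assert (zu : Cplus (hermS eps (DeriveC2 (DeriveC2 c) x) (c x))
                   (hermS eps (DeriveC2 c x) (DeriveC2 c x)) = RtoC 0).
{ rewrite <- (is_deriveC_unique _ _ _ hu). apply is_deriveC_unique.
  apply (is_deriveC_ext_loc (fun _ => RtoC 0)); [|apply is_deriveC_const].
  apply (filter_imp D); trivial. intros y hy. symmetry. apply (hf y hy). }
assert (zv : Cplus (hermS eps (DeriveC2 (DeriveC2 c) x) (DeriveC2 c x))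
                   (hermS eps (DeriveC2 c x) (DeriveC2 (DeriveC2 c) x)) = RtoC 0).
{ rewrite <- (is_deriveC_unique _ _ _ hv). apply is_deriveC_unique.
  apply (is_deriveC_ext_loc (fun _ => RtoC 1)); [|apply is_deriveC_const].
  apply (filter_imp D); trivial. intros y hy. symmetry. apply (hf y hy). }
pose proof (hf x hx) as frame.
pose proof (legendre_frame_expansion eps _ _ (DeriveC2 (DeriveC2 c) x) he frame) as hw.
destruct frame as (_ & hvv & _).
rewrite hvv in zu.
rewrite (hermS_conj eps (DeriveC2 (DeriveC2 c) x) (DeriveC2 c x)) in zv.
set (w := DeriveC2 (DeriveC2 c) x) in *. set (v := DeriveC2 c x) in *.
assert (hwu : hermS eps w (c x) = (- RtoC 1)%C).
{ transitivity (hermS eps w (c x) + RtoC 1 - RtoC 1)%C; [ring|]. rewrite zu. ring. }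
assert (hwv : hermS eps w v = Cmult Ci (RtoC (Re (hermS eps w (C2mulI v))))).
{ replace (hermS eps w (C2mulI v)) with (- (Ci * hermS eps w v))%C.
  - pose proof (f_equal Re zv) as hre.
    revert hre. destruct (hermS eps w v) as [p q]. simpl. intros hre.
    apply injective_projections; simpl; lra.
  - unfold hermS, C2mulI; simpl. rewrite !Cmult_conj.
    replace (Cconj Ci) with (- Ci)%C by (apply injective_projections; simpl; ring).
    ring. }
rewrite hwu, hwv in hw.
set (k := Re _) in *. clearbody k.
rewrite hw at 1.
unfold C2plus, C2mulI, C2scal; simpl.
rewrite RtoC_opp. f_equal; ring.
Qed.

(** * Mean curvature of a conformal Lagrangian parametrization *)

Lemma inner_plus_l u v w : inner (C2plus u v) w = inner u w + inner v w.
Proof. unfold inner, herm, C2plus, Re; simpl; ring. Qed.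

Lemma normal_part_plus f t s v w :
  C2plus (normal_part f t s v) (normal_part f t s w) = normal_part f t s (C2plus v w).
Proof.
unfold normal_part, tangent_part. rewrite !inner_plus_l. unfold Rdiv.
apply injective_projections; apply injective_projections; simpl; ring.
Qed.

Lemma normal_part_id f t s v :
  inner v (partial1 f t s) = 0 -> inner v (partial2 f t s) = 0 ->
  normal_part f t s v = v.
Proof.
intros h1 h2. unfold normal_part, tangent_part. rewrite h1, h2. unfold Rdiv.
apply injective_projections; apply injective_projections; simpl; ring.
Qed.

(** Multiplication by [i] carries the tangent plane of a Lagrangian surface to
    the normal plane. *)
Lemma lagrangian_normal p q a b :
  herm p q = RtoC 0 ->
  inner (C2mulI (C2plus (C2scal a p) (C2scal b q))) p = 0 /\
  inner (C2mulI (C2plus (C2scal a p) (C2scal b q))) q = 0.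
Proof.
intros h.
assert (hr := f_equal Re h). assert (hi := f_equal Im h).
revert hr hi. destruct p as [[p1 p2] [p3 p4]], q as [[q1 q2] [q3 q4]].
unfold inner, herm; simpl. intros hr hi. split.
- transitivity (b * (p2 * q1 + p1 * (- q2) + (p4 * q3 + p3 * - q4))); [ring|].
  replace (p2 * q1 + p1 * (- q2) + (p4 * q3 + p3 * - q4)) with 0 by lra. ring.
- transitivity (- a * (p1 * - q2 + p2 * q1 + (p3 * - q4 + p4 * q3))); [ring|].
  rewrite hi. ring.
Qed.

(** For a conformal parametrization the trace of the second fundamental form is
    [1 / e] times the normal part of the coordinate Laplacian [f_tt + f_ss],
    which is here already normal. *)
Lemma conformal_lagrangian_mean_curvature f t s a b e :
  e <> 0 -> g11 f t s = e -> g22 f t s = e ->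
  herm (partial1 f t s) (partial2 f t s) = RtoC 0 ->
  C2plus (partial1 (partial1 f) t s) (partial2 (partial2 f) t s) =
    C2mulI (C2plus (C2scal a (partial1 f t s)) (C2scal b (partial2 f t s))) ->
  inner (mean_curvature_vector f t s) (mean_curvature_vector f t s)
    = (a ^ 2 + b ^ 2) / (4 * e).
Proof.
intros he h11 h22 h12 hlap.
assert (hg12 : g12 f t s = 0) by exact (f_equal Re h12).
assert (hH : mean_curvature_vector f t s = C2scal (/ (2 * e))
   (C2mulI (C2plus (C2scal a (partial1 f t s)) (C2scal b (partial2 f t s))))).
{ destruct (lagrangian_normal _ _ a b h12) as [n1 n2].
  rewrite <- hlap in *. rewrite <- (normal_part_id f t s _ n1 n2) at 1.
  rewrite <- normal_part_plus.
  unfold mean_curvature_vector, trace_sigma, sigma11, sigma22, detg.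
  generalize (normal_part f t s (partial1 (partial1 f) t s))
    (normal_part f t s (partial2 (partial2 f) t s)) (sigma12 f t s).
  intros u v w. rewrite hg12, h11, h22.
  replace (e * e - 0 ^ 2) with (e ^ 2) by ring.
  apply injective_projections; apply injective_projections; simpl; field; trivial. }
rewrite hH.
(* Multiplication by [i] is an isometry, so only the metric coefficients enter. *)
transitivity (/ (4 * e ^ 2) * (a ^ 2 * g11 f t s + b ^ 2 * g22 f t s
   + 2 * a * b * g12 f t s)).
{ unfold g11, g22, g12.
  generalize (partial1 f t s), (partial2 f t s).
  intros [[p1 p2] [p3 p4]] [[q1 q2] [q3 q4]].
  unfold inner, herm; simpl. field. trivial. }
rewrite h11, h22, hg12. field. trivial.
Qed.

(** * The product surface *)

Lemma is_deriveC2_product_l alpha l v t :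
  is_deriveC2 alpha t l ->
  is_deriveC2 (fun y => (Cmult (fst (alpha y)) (fst v), Cmult (snd (alpha y)) (snd v)))
    t (Cmult (fst l) (fst v), Cmult (snd l) (snd v)).
Proof. intros [h1 h2]; split; simpl; now apply is_deriveC_mult_const. Qed.

Lemma is_deriveC2_product_r gamma l v s :
  is_deriveC2 gamma s l ->
  is_deriveC2 (fun y => (Cmult (fst v) (fst (gamma y)), Cmult (snd v) (snd (gamma y))))
    s (Cmult (fst v) (fst l), Cmult (snd v) (snd l)).
Proof. intros [h1 h2]; split; simpl; now apply is_deriveC_const_mult. Qed.

Lemma product_surface_partial1 D alpha gamma t s :
  smooth_curve_on D alpha -> D t ->
  partial1 (product_surface alpha gamma) t s = product_surface (DeriveC2 alpha) gamma t s.
Proof.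
intros h ht. apply is_deriveC2_unique.
now apply is_deriveC2_product_l, (smooth_curve_derive D).
Qed.

Lemma product_surface_partial2 D alpha gamma t s :
  smooth_curve_on D gamma -> D s ->
  partial2 (product_surface alpha gamma) t s = product_surface alpha (DeriveC2 gamma) t s.
Proof.
intros h hs. apply is_deriveC2_unique.
now apply is_deriveC2_product_r, (smooth_curve_derive D).
Qed.

Lemma product_surface_partial11 D alpha gamma t s :
  smooth_curve_on D alpha -> locally t D ->
  partial1 (partial1 (product_surface alpha gamma)) t s =
    product_surface (DeriveC2 (DeriveC2 alpha)) gamma t s.
Proof.
intros h ht. apply is_deriveC2_unique.
apply (is_deriveC2_ext_loc (fun y => product_surface (DeriveC2 alpha) gamma y s)).
- apply (filter_imp D); trivial. intros y hy. symmetry.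
  now apply (product_surface_partial1 D).
- apply is_deriveC2_product_l, (smooth_curve_derive2 D); trivial.
  now apply locally_singleton.
Qed.

Lemma product_surface_partial22 D alpha gamma t s :
  smooth_curve_on D gamma -> locally s D ->
  partial2 (partial2 (product_surface alpha gamma)) t s =
    product_surface alpha (DeriveC2 (DeriveC2 gamma)) t s.
Proof.
intros h hs. apply is_deriveC2_unique.
apply (is_deriveC2_ext_loc (fun y => product_surface alpha (DeriveC2 gamma) t y)).
- apply (filter_imp D); trivial. intros y hy. symmetry.
  now apply (product_surface_partial2 D).
- apply is_deriveC2_product_r, (smooth_curve_derive2 D); trivial.
  now apply locally_singleton.
Qed.

Lemma inner_mult_self a1 a2 g1 g2 :
  inner (Cmult a1 g1, Cmult a2 g2) (Cmult a1 g1, Cmult a2 g2) =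
    Cmod a1 ^ 2 * Cmod g1 ^ 2 + Cmod a2 ^ 2 * Cmod g2 ^ 2.
Proof. rewrite !Cmod2_alt. unfold inner, herm, Re, Im; simpl; ring. Qed.

Lemma inner_self_eq_0 v : inner v v = 0 -> v = C2zero.
Proof.
destruct v as [[p q] [r u]]. unfold inner, herm, C2zero, RtoC; simpl. intros h.
assert (h' : p * p + q * q + r * r + u * u = 0) by lra.
assert (p = 0 /\ q = 0 /\ r = 0 /\ u = 0) as (-> & -> & -> & ->).
{ pose proof (Rle_0_sqr p). pose proof (Rle_0_sqr q).
  pose proof (Rle_0_sqr r). pose proof (Rle_0_sqr u). unfold Rsqr in *.
  repeat split; apply Rsqr_0_uniq; unfold Rsqr; lra. }
reflexivity.
Qed.

(** By the first hypothesis the two products [p_j conj(u_j)] agree, so they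
    factor out of the second one. *)
Lemma herm_product p u v q :
  herm11 p u = RtoC 0 -> herm v q = RtoC 0 ->
  herm (Cmult (fst p) (fst v), Cmult (snd p) (snd v))
       (Cmult (fst u) (fst q), Cmult (snd u) (snd q)) = RtoC 0.
Proof.
destruct p as [p1 p2], u as [u1 u2], v as [v1 v2], q as [q1 q2].
unfold herm11, herm; simpl. rewrite !Cmult_conj. intros h1 h2.
transitivity ((p1 * Cconj u1) * (v1 * Cconj q1 + v2 * Cconj q2)
  - (p1 * Cconj u1 - p2 * Cconj u2) * (v2 * Cconj q2))%C; [ring|].
rewrite h1, h2. ring.
Qed.

Section ProductSurface.

Variables (I J : R -> Prop) (alpha gamma : R -> C2).
Hypotheses (halpha : legendre_H31 I alpha) (hgamma : legendre_S3 J gamma).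

Let phi := product_surface alpha gamma.
Let conformal_factor t s := Cmod (fst (gamma s)) ^ 2 + Cmod (fst (alpha t)) ^ 2.

Lemma product_surface_conformal t s : I t -> J s ->
  g11 phi t s = conformal_factor t s /\ g22 phi t s = conformal_factor t s /\
  herm (partial1 phi t s) (partial2 phi t s) = RtoC 0.
Proof.
intros ht hs.
destruct (legendre_H31_curve _ _ halpha) as [sa fa].
destruct (legendre_S3_curve _ _ hgamma) as [sg fg].
destruct (legendre_frame_moduli (-1) _ _ ltac:(ring) (fa t ht)) as (a1 & a2 & a3).
destruct (legendre_frame_moduli 1 _ _ ltac:(ring) (fg s hs)) as (c1 & c2 & c3).
unfold g11, g22, phi, conformal_factor.
rewrite (product_surface_partial1 I), (product_surface_partial2 J); trivial.
unfold product_surface. rewrite !inner_mult_self, a1, a2, a3, c1, c2, c3.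
split; [ring|]. split; [ring|].
destruct (fa t ht) as (_ & _ & oa). destruct (fg s hs) as (_ & _ & og).
rewrite hermS_m1 in oa. rewrite hermS_1 in og.
apply herm_product; trivial.
rewrite <- hermS_1, hermS_conj, hermS_1, og.
apply injective_projections; simpl; ring.
Qed.

(** The positional terms of the two differential equations have opposite signs,
    as the two quadrics do, and cancel. *)
Lemma product_surface_laplacian t s : locally t I -> locally s J ->
  C2plus (partial1 (partial1 phi) t s) (partial2 (partial2 phi) t s) =
  C2mulI (C2plus (C2scal (curvature_H31 alpha t) (partial1 phi t s))
                 (C2scal (curvature_S3 gamma s) (partial2 phi t s))).
Proof.
intros lt ls.
assert (ht := locally_singleton _ _ lt). assert (hs := locally_singleton _ _ ls).
pose proof (legendre_H31_curve _ _ halpha) as ca.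
pose proof (legendre_S3_curve _ _ hgamma) as cg.
pose proof (legendre_curve_ode (-1) I alpha t ltac:(ring) ca lt) as oa.
pose proof (legendre_curve_ode 1 J gamma s ltac:(ring) cg ls) as og.
rewrite hermS_m1 in oa. rewrite hermS_1 in og.
fold (curvature_H31 alpha t) in oa. fold (curvature_S3 gamma s) in og.
destruct ca as [sa _], cg as [sg _].
unfold phi.
rewrite (product_surface_partial11 I), (product_surface_partial22 J),
  (product_surface_partial1 I), (product_surface_partial2 J); trivial.
unfold product_surface. rewrite oa, og.
generalize (curvature_H31 alpha t), (curvature_S3 gamma s). intros k l.
apply injective_projections; apply injective_projections; simpl; ring.
Qed.

(** The factor is the squared length of [phi_t], so where it vanishes
    the coordinate vector of [t] lies in the kernel of the differential. *)
Lemma product_surface_conformal_factor_neq0 t s :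
  immersion_on I J phi -> I t -> J s -> conformal_factor t s <> 0.
Proof.
intros himm ht hs he.
destruct (product_surface_conformal t s ht hs) as (h11 & _ & _).
rewrite he in h11. apply inner_self_eq_0 in h11.
destruct (himm t s ht hs 1 0) as [h _]; [|lra].
rewrite h11.
apply injective_projections; apply injective_projections; simpl; ring.
Qed.

Lemma product_surface_mean_curvature_eq rho t s :
  immersion_on I J phi -> 0 < rho -> locally t I -> locally s J ->
  C2norm (mean_curvature_vector phi t s) = rho <->
  curvature_H31 alpha t ^ 2 + curvature_S3 gamma s ^ 2 =
    4 * rho ^ 2 * (Cmod (fst (gamma s)) ^ 2 + Cmod (fst (alpha t)) ^ 2).
Proof.
intros himm hrho lt ls.
assert (ht := locally_singleton _ _ lt). assert (hs := locally_singleton _ _ ls).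
pose proof (product_surface_conformal_factor_neq0 t s himm ht hs) as he.
destruct (product_surface_conformal t s ht hs) as (h11 & h22 & h12).
pose proof (conformal_lagrangian_mean_curvature phi t s _ _ _ he h11 h22 h12
  (product_surface_laplacian t s lt ls)) as hH.
unfold C2norm. rewrite hH. fold (conformal_factor t s).
set (e := conformal_factor t s) in *.
set (k := curvature_H31 alpha t ^ 2 + curvature_S3 gamma s ^ 2) in *.
assert (hk : 0 <= k) by (apply Rplus_le_le_0_compat; apply pow2_ge_0).
assert (hepos : 0 < e).
{ assert (0 <= e) by (apply Rplus_le_le_0_compat; apply pow2_ge_0). lra. }
split; intros h.
- rewrite <- h, pow2_sqrt; [field; trivial|].
  apply Rdiv_le_0_compat; lra.
- rewrite h. replace (4 * rho ^ 2 * e / (4 * e)) with (rho ^ 2) by (field; trivial).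
  apply sqrt_pow2. lra.
Qed.

End ProductSurface.

Theorem theorem4p3 (a1 b1 a2 b2 : Rbar)
  (hI1 : Rbar_lt a1 b1) (hI2 : Rbar_lt a2 b2)
  (gamma alpha : R -> C2)
  (hgamma : legendre_S3 (open_itv a1 b1) gamma)
  (halpha : legendre_H31 (open_itv a2 b2) alpha)
  (himm : immersion_on (open_itv a2 b2) (open_itv a1 b1)
            (product_surface alpha gamma))
  (rho : R) (hrho : 0 < rho) :
  (forall t s : R, open_itv a2 b2 t -> open_itv a1 b1 s ->
     C2norm (mean_curvature_vector (product_surface alpha gamma) t s) = rho)
  <->
  (exists lambda : R,
     (forall s : R, open_itv a1 b1 s ->
        curvature_S3 gamma s ^ 2 = 4 * rho ^ 2 * Cmod (fst (gamma s)) ^ 2 - lambda)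
     /\
     (forall t : R, open_itv a2 b2 t ->
        curvature_H31 alpha t ^ 2 = 4 * rho ^ 2 * Cmod (fst (alpha t)) ^ 2 + lambda)).
Proof.
assert (key : forall t s, open_itv a2 b2 t -> open_itv a1 b1 s ->
  C2norm (mean_curvature_vector (product_surface alpha gamma) t s) = rho <->
  curvature_H31 alpha t ^ 2 + curvature_S3 gamma s ^ 2 =
    4 * rho ^ 2 * (Cmod (fst (gamma s)) ^ 2 + Cmod (fst (alpha t)) ^ 2)).
{ intros t s ht hs.
  now apply (product_surface_mean_curvature_eq (open_itv a2 b2) (open_itv a1 b1));
    try apply open_itv_locally. }
split.
- intros h.
  assert (h' := fun t s ht hs => proj1 (key t s ht hs) (h t s ht hs)).
  destruct (open_itv_inhabited a1 b1 hI1) as [s0 hs0].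
  destruct (open_itv_inhabited a2 b2 hI2) as [t0 ht0].
  (* [lambda] is the value at [t0] of the side depending on [t]; the point [s0]
     transfers it to the other [t]. *)
  exists (curvature_H31 alpha t0 ^ 2 - 4 * rho ^ 2 * Cmod (fst (alpha t0)) ^ 2).
  split.
  + intros s hs. pose proof (h' t0 s ht0 hs). lra.
  + intros t ht. pose proof (h' t0 s0 ht0 hs0). pose proof (h' t s0 ht hs0). lra.
- intros [lambda [hg ha]] t s ht hs.
  apply (key t s ht hs). rewrite (hg s hs), (ha t ht). ring.
Qed.
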